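(* Let $p(w)=(w-w_1)(w-w_2)(w-w_3)$ with $w_1,w_2,w_3\in\mathbb{C}$ and $\operatorname{Re}w_1<\operatorname{Re}w_2<\operatorname{Re}w_3$. Let $z_1$ and $z_2$ be the critical points of $p$ (the two zeros of $p'$, counted with multiplicity), where either $z_1=z_2$, or $\operatorname{Re}z_1<\operatorname{Re}z_2$ if $z_1\neq z_2$. Let $\sigma_1=\dfrac{z_1-w_1}{w_2-w_1}$ and $\sigma_2=\dfrac{z_2-w_2}{w_3-w_2}$. Then $\sigma_1$ or $\sigma_2$ is real if and only if $w_1,w_2,w_3$ are collinear (as points of the plane $\mathbb{C}$).
   Context: The pair $(\sigma_1,\sigma_2)$ is the (complex) ratio vector of the cubic $p$. It is defined only when the three roots have pairwise distinct real parts and the two critical points either coincide or have distinct real parts; the roots and critical points are indexed by increasing real part. *)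

(* Defs.v *)
From HB Require Import structures.
From mathcomp Require Import all_boot all_order all_algebra.
From mathcomp Require Import complex reals.

Set Implicit Arguments.
Unset Strict Implicit.
Unset Printing Implicit Defensive.

Import Order.TTheory GRing.Theory Num.Theory.

Local Open Scope ring_scope.
Local Open Scope complex_scope.

Definition cubic (R : realType) (w1 w2 w3 : R[i]) : {poly R[i]} :=
  ('X - w1%:P) * ('X - w2%:P) * ('X - w3%:P).

(* Full factorization of the derivative, so that zeros are counted with
   multiplicity: z1 = z2 is allowed exactly when the zero is double. *)
Definition critical_points (R : realType) (p : {poly R[i]}) (z1 z2 : R[i]) :
  Prop :=
  p^`() = lead_coef p^`() *: (('X - z1%:P) * ('X - z2%:P)).

Definition on_line (R : realType) (a d w : R[i]) : Prop :=
  exists t : R, w = a + t%:C * d.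

Definition collinear (R : realType) (w1 w2 w3 : R[i]) : Prop :=
  exists a d : R[i],
    [/\ d != 0, on_line a d w1, on_line a d w2 & on_line a d w3].

(* Main.v *)
(** Normalise the triangle by [x = 0], [y = 1], the third point becoming
    [tau = (w - x) / (y - x)] and a critical point [z] becoming
    [u = (z - x) / (y - x)]. Then [3 u^2 - 2 (1 + tau) u + tau = 0]. This is
    affine in [tau], with the coefficient of [tau] vanishing only at [u = 1/2],
    which is not a solution; hence [u] real forces [tau] real. As a quadratic
    in [u] it has discriminant [4 (1 - tau + tau^2)], positive for real [tau];
    hence [tau] real forces [u] real. Finally [tau] is real iff the three
    points are collinear. *)
Require Import Defs.
From HB Require Import structures.
From mathcomp Require Import all_boot all_order all_algebra.
From mathcomp Require Import complex reals.
From mathcomp Require Import ring.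

Set Implicit Arguments.
Unset Strict Implicit.
Unset Printing Implicit Defensive.

Import Order.TTheory GRing.Theory Num.Theory.

Local Open Scope ring_scope.
Local Open Scope complex_scope.

(** Up to sign, [x] is the nonnegative square root of [x ^+ 2]. *)
Lemma real_of_sqr_ge0 (C : numClosedFieldType) (x : C) :
  0 <= x ^+ 2 -> x \is Num.real.
Proof.
move=> x2_ge0; have s_ge0 : 0 <= sqrtC (x ^+ 2) by rewrite sqrtC_ge0.
have /eqP := sqrtCK (x ^+ 2).
rewrite eqf_sqr => /orP[] /eqP s_eq; move/ger0_real: s_ge0; rewrite s_eq //.
by rewrite rpredN.
Qed.

Lemma real_critical_ratio (C : numClosedFieldType) (u tau : C) :
  3 * u ^+ 2 - 2 * (1 + tau) * u + tau = 0 ->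
  (u \is Num.real) = (tau \is Num.real).
Proof.
move=> eq0; apply/idP/idP => [u_real|tau_real].
  have nz : 1 - 2 * u != 0.
    apply/eqP => u_half.
    have /eqP : (1 : C) = 0.
      (* Bezout identity: [1 - 2 * u] and the quadratic have no common zero. *)
      have -> : (1 : C) = (1 - 2 * u) * (1 + 4 * tau - 6 * u)
        - 4 * (3 * u ^+ 2 - 2 * (1 + tau) * u + tau) by ring.
      by rewrite u_half eq0 mul0r mulr0 subrr.
    by rewrite oner_eq0.
  suff -> : tau = u * (2 - 3 * u) / (1 - 2 * u).
    by rewrite rpred_div ?rpredM ?rpredB ?rpredM ?realn ?rpred1.
  by apply/(canRL (mulfK nz))/subr0_eq; rewrite -eq0; ring.
have r_real : tau - 2^-1 \is Num.real.
  by rewrite rpredB ?rpredV ?realn.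
have v_real : 3 * u - (1 + tau) \is Num.real.
  apply: real_of_sqr_ge0.
  (* Completing the square in [u]: the right-hand side is a quarter of the discriminant,
     [1 - tau + tau ^+ 2]. *)
  have -> : (3 * u - (1 + tau)) ^+ 2 = (tau - 2^-1) ^+ 2 + 3 / 4.
    apply/subr0_eq; rewrite -[RHS](mulr0 3) -eq0; field.
    by rewrite ?pnatr_eq0.
  by rewrite addr_ge0 ?real_exprn_even_ge0 // divr_ge0 ?ler0n.
have -> : u = (3 * u - (1 + tau) + (1 + tau)) / 3.
  by field; rewrite ?pnatr_eq0.
by rewrite rpred_div ?realn ?(rpredD v_real) ?rpredD ?rpred1.
Qed.

Lemma horner_deriv_cubic (R : realType) (w1 w2 w3 z : R[i]) :
  (cubic w1 w2 w3)^`().[z] =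
  (z - w1) * (z - w2) + (z - w2) * (z - w3) + (z - w3) * (z - w1).
Proof.
rewrite /cubic !derivM !derivXsubC !mulr1 !mul1r.
by rewrite !(hornerXsubC, hornerM, hornerD); ring.
Qed.

Lemma collinear_rot (R : realType) (w1 w2 w3 : R[i]) :
  collinear w1 w2 w3 <-> collinear w2 w3 w1.
Proof. by split=> -[a [d [nz l1 l2 l3]]]; exists a, d. Qed.

Lemma real_ratio_collinear (R : realType) (x y w : R[i]) : x != y ->
  (w - x) / (y - x) \is Num.real <-> collinear x y w.
Proof.
move=> xy; have nz : y - x != 0 by rewrite subr_eq0 eq_sym.
split=> [/complex_realP[t tE]|].
  exists x, (y - x); split=> //.
  - by exists 0; rewrite mul0r addr0.
  - by exists 1; rewrite mul1r addrC subrK.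
  - by exists t; rewrite -tE divfK // addrC subrK.
case=> a [d [d_nz [r rE] [s sE] [t tE]]].
have subE (p q : R) : a + p%:C * d - (a + q%:C * d) = (p - q)%:C * d.
  by rewrite rmorphB /=; ring.
apply/complex_realP; exists ((t - r) / (s - r)).
by rewrite rE sE tE !subE -mulf_div divff // mulr1 fmorph_div.
Qed.

Lemma real_ratio_deriv_root (R : realType) (x y w z : R[i]) : x != y ->
  (z - x) * (z - y) + (z - y) * (z - w) + (z - w) * (z - x) = 0 ->
  (z - x) / (y - x) \is Num.real <-> collinear x y w.
Proof.
move=> xy z_crit; have nz : y - x != 0 by rewrite subr_eq0 eq_sym.
rewrite -real_ratio_collinear //
  (@real_critical_ratio _ _ ((w - x) / (y - x))) //.
(* The critical equation is homogeneous of degree 2 in differences of points, so dividing by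
   [(y - x) ^+ 2] normalises it. *)
by rewrite -[RHS](mul0r ((y - x) ^- 2)) -z_crit; field.
Qed.

Theorem theorem5 (R : realType) (w1 w2 w3 z1 z2 : R[i])
  (hw12 : complex.Re w1 < complex.Re w2)
  (hw23 : complex.Re w2 < complex.Re w3)
  (hcrit : critical_points (cubic w1 w2 w3) z1 z2)
  (hz : z1 = z2 \/ complex.Re z1 < complex.Re z2) :
  let sigma1 := (z1 - w1) / (w2 - w1) in
  let sigma2 := (z2 - w2) / (w3 - w2) in
  (sigma1 \is Num.real \/ sigma2 \is Num.real) <-> collinear w1 w2 w3.
Proof.
have neq_of_ltRe (x y : R[i]) : complex.Re x < complex.Re y -> x != y.
  by apply: contraTneq => ->; rewrite ltxx.
have crit z : (z == z1) || (z == z2) -> (cubic w1 w2 w3)^`().[z] = 0.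
  by rewrite hcrit hornerZ hornerM !hornerXsubC => /orP[] /eqP ->;
    rewrite subrr ?mul0r !mulr0.
move=> sigma1 sigma2.
(* Each ratio by itself is real exactly when the roots are collinear, so the disjunction
   collapses. *)
have real1 : sigma1 \is Num.real <-> collinear w1 w2 w3.
  apply: real_ratio_deriv_root; first exact: neq_of_ltRe.
  by rewrite -horner_deriv_cubic crit ?eqxx.
have real2 : sigma2 \is Num.real <-> collinear w1 w2 w3.
  (* A cyclic shift of the roots makes [w2], [w3] the normalised pair; the critical equation is
     invariant under it. *)
  rewrite collinear_rot; apply: real_ratio_deriv_root.
    exact: neq_of_ltRe.
  have <- := crit z2; last by rewrite eqxx orbT.
  by rewrite horner_deriv_cubic; ring.
by rewrite real1 real2; split=> [[]|]; auto.
Qed.
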